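(* Let $p$ be an odd prime, $q\in\mathbb{C}_p$ with $|q-1|_p<1$, $h\in\mathbb{Z}$ and $\zeta\in T_p$. Then $$E^{(h)}_{0,q,\zeta}=\frac{1+q}{1+q^h\zeta},$$ and for every integer $n>0$, $$q^h\zeta\,(qE^{(h)}_{q,\zeta}+1)^n+E^{(h)}_{n,q,\zeta}=0,$$ where, after expanding by the binomial theorem, $(E^{(h)}_{q,\zeta})^l$ is replaced by $E^{(h)}_{l,q,\zeta}$ (i.e. $q^h\zeta\sum_{l=0}^n\binom{n}{l}q^lE^{(h)}_{l,q,\zeta}+E^{(h)}_{n,q,\zeta}=0$).
   Context: $\mathbb{Z}_p$, $\mathbb{C}_p$ denote the $p$-adic integers and the completion of the algebraic closure of $\mathbb{Q}_p$. $T_p=\bigcup_{n\ge1}\{\zeta\in\mathbb{C}_p:\zeta^{p^n}=1\}$; for $\zeta\in T_p$ and $y\in\mathbb{Z}_p$, $\zeta^y$ is defined by continuity. $[x]_q=\frac{1-q^x}{1-q}$. For uniformly differentiable $f:\mathbb{Z}_p\to\mathbb{C}_p$, $\int_{\mathbb{Z}_p}f(x)\,d\mu_{-q}(x)=\lim_{N\to\infty}\frac{1+q}{1+q^{p^N}}\sum_{x=0}^{p^N-1}f(x)(-q)^x$. The twisted $(h,q)$-Euler polynomials are $E^{(h)}_{n,q,\zeta}(x)=\int_{\mathbb{Z}_p}[x+y]_q^n\zeta^y q^{(h-1)y}\,d\mu_{-q}(y)$ for $n\in\mathbb{Z}_+=\{0,1,2,\dots\}$, and $E^{(h)}_{n,q,\zeta}=E^{(h)}_{n,q,\zeta}(0)$.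 *)

(* Defs.v *)
From HB Require Import structures.
From mathcomp Require Import all_boot all_order all_algebra.
From mathcomp Require Import all_classical all_reals all_analysis.

Set Implicit Arguments.
Unset Strict Implicit.
Unset Printing Implicit Defensive.

Import Order.TTheory GRing.Theory Num.Theory.

Local Open Scope classical_set_scope.
Local Open Scope ring_scope.

HB.mixin Record isUltrametric (R : realType) K & GRing.Field K := {
  absv : K -> R;
  absv_ge0 : forall x, 0 <= absv x;
  absv_eq0 : forall x, absv x = 0 <-> x = 0;
  absvM : forall x y, absv (x * y) = absv x * absv y;
  absvD_max : forall x y, absv (x + y) <= Num.max (absv x) (absv y) }.

(* Fields with a real-valued non-archimedean absolute value. *)
#[short(type="ultrametricFieldType")]
HB.structure Definition UltrametricField (R : realType) :=
  {K of GRing.Field K & isUltrametric R K}.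

Section UltrametricTopology.
Variables (R : realType) (K : ultrametricFieldType R).
Implicit Types x y : K.

Lemma absv1 : absv (1 : K) = 1 :> R.
Proof.
have n0 : absv (1 : K) != 0 :> R.
  by apply/eqP => /absv_eq0/eqP; rewrite oner_eq0.
by apply: (mulfI n0); rewrite -absvM !mulr1.
Qed.

Lemma absvN x : absv (- x) = absv x :> R.
Proof.
suff N1 : absv (-1 : K) = 1 :> R by rewrite -mulN1r absvM N1 mul1r.
by apply/eqP; rewrite -(@pexpr_eq1 _ _ 2) ?absv_ge0// expr2 -absvM mulrNN mulr1
  absv1.
Qed.

Lemma absvD x y : absv (x + y) <= absv x + absv y :> R.
Proof.
by rewrite (le_trans (absvD_max x y))// ge_max lerDl lerDr !absv_ge0.
Qed.

(* The metric topology of the absolute value, with balls absv (x - y) < e. The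
   library's norm `|_| is unusable here, as its axiom `|x *+ n| = `|x| *+ n
   fails for non-archimedean absolute values. *)
Definition absv_ball (x : K) (e : R) : set K := [set y | absv (x - y) < e].

Definition absv_ent : set_system (K * K) := entourage_ absv_ball.

Definition absv_nbhs (x : K) : set_system K := nbhs_ absv_ent x.

Let absv_nbhsE : absv_nbhs = nbhs_ absv_ent. Proof. by []. Qed.

Let absv_ball_center x (e : R) : 0 < e -> absv_ball x e x.
Proof. by rewrite /absv_ball/= subrr (absv_eq0 0).2. Qed.

Let absv_ball_sym x y (e : R) : absv_ball x e y -> absv_ball y e x.
Proof. by rewrite /absv_ball/= -absvN opprB. Qed.

Let absv_ball_triangle x y z (e1 e2 : R) :
  absv_ball x e1 y -> absv_ball y e2 z -> absv_ball x (e1 + e2) z.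
Proof.
rewrite /absv_ball/= => hxy hyz; rewrite -(subrKA y).
by rewrite (le_lt_trans (absvD _ _))// ltrD.
Qed.

Let absv_entE : absv_ent = entourage_ absv_ball. Proof. by []. Qed.

#[non_forgetful_inheritance]
HB.instance Definition _ := hasNbhs.Build K absv_nbhs.
#[non_forgetful_inheritance]
HB.instance Definition _ := @Nbhs_isPseudoMetric.Build R K
  absv_ent absv_nbhsE absv_ball absv_ball_center absv_ball_sym
  absv_ball_triangle absv_entE.
#[non_forgetful_inheritance]
HB.instance Definition _ := isPointed.Build K 0.

Definition complete_field : Prop :=
  forall F : set_system K, ProperFilter F -> cauchy F -> cvg F.

End UltrametricTopology.

Section ValuationRing.
Variables (R : realType) (K : ultrametricFieldType R).

Definition unit_ball : {pred K} := fun x => absv x <= 1 :> R.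

Lemma unit_ball_subring : subring_closed unit_ball.
Proof.
split.
- by rewrite unfold_in absv1.
- move=> x y; rewrite !unfold_in => hx hy.
  by rewrite (le_trans (absvD_max _ _)) // absvN ge_max hx hy.
- by move=> x y; rewrite !unfold_in absvM => hx hy; rewrite mulr_ile1 ?absv_ge0.
Qed.

HB.instance Definition _ :=
  GRing.isSubringClosed.Build K unit_ball unit_ball_subring.

Record valuation_ring := ValuationRing {
  vring_val : K; _ : vring_val \in unit_ball }.

HB.instance Definition _ := [isSub for vring_val].
HB.instance Definition _ := [Choice of valuation_ring by <:].
HB.instance Definition _ :=
  [SubChoice_isSubComNzRing of valuation_ring by <:].

End ValuationRing.

Section PadicFields.
Variable R : realType.

Definition padic_abs (p : nat) (x : rat) : R :=
  if x == 0 then 0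
  else p%:R ^+ logn p `|denq x|%N / p%:R ^+ logn p `|numq x|%N.

(* [Qp] is the completion of the rationals for the p-adic absolute value. *)
Definition is_Qp (p : nat) (Qp : ultrametricFieldType R) : Prop :=
  [/\ complete_field Qp,
      forall x : rat, absv (ratr x : Qp) = padic_abs p x
    & dense (range (ratr : rat -> Qp))].

Definition isometric (K L : ultrametricFieldType R) (f : K -> L) : Prop :=
  forall x, absv (f x) = absv x :> R.

Definition is_algebraic_closure (K L : fieldType) (i : {rmorphism K -> L}) :
    Prop :=
  GRing.closed_field_axiom L /\ forall x : L, algebraicOver i x.

(* [iota] is the embedding of [Qp] in the completion [Cp] of an algebraic
   closure [L] of [Qp], where [L] carries the absolute value extending that of
   [Qp]. *)
Definition is_Cp (Qp Cp : ultrametricFieldType R)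
    (iota : {rmorphism Qp -> Cp}) : Prop :=
  exists (L : ultrametricFieldType R) (i : {rmorphism Qp -> L})
         (j : {rmorphism L -> Cp}),
    [/\ is_algebraic_closure i, isometric i & iota =1 j \o i] /\
    [/\ complete_field Cp, isometric j & dense (range j)].

End PadicFields.

Section TwistedEuler.
Variables (R : realType) (p : nat).
Variables (Qp Cp : ultrametricFieldType R).
Variable iota : {rmorphism Qp -> Cp}.

Local Notation Zp := (valuation_ring Qp).

Definition Tp : set Cp :=
  [set z | exists n : nat, (1 <= n)%N /\ z ^+ (p ^ n) = 1].

(* The filter on [nat] of the natural numbers tending p-adically to [y]. *)
Definition padic_near (y : Zp) : set_system nat :=
  filter_from (nbhs (vring_val y)) (fun B => [set n : nat | B n%:R]).

(* z ^ y for a p-adic integer y, extending n |-> z ^+ n by continuity; this is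
   meaningful when absv (z - 1) < 1, in particular for z in [Tp]. *)
Definition padic_pow (z : Cp) (y : Zp) : Cp :=
  lim (z ^+ n @[n --> padic_near y]).

(* [x]_q, which at q = 1 takes its limit value x. *)
Definition qnum (q : Cp) (x : Zp) : Cp :=
  if q == 1 then iota (vring_val x) else (1 - padic_pow q x) / (1 - q).

(* The integral of f over Zp against mu_{-q}; an unspecified value when the
   limit does not exist. *)
Definition fermionic_integral (q : Cp) (f : Zp -> Cp) : Cp :=
  lim ((1 + q) / (1 + q ^+ (p ^ N)) *
       (\sum_(0 <= x < p ^ N) f x%:R * (- q) ^+ x) @[N --> \oo]).

Definition twisted_Euler_poly (h : int) (n : nat) (q zeta : Cp) (x : Zp) : Cp :=
  fermionic_integral q (fun y : Zp =>
    qnum q (x + y) ^+ n * padic_pow zeta y * padic_pow q ((h - 1)%:~R * y)).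

Definition twisted_Euler_number (h : int) (n : nat) (q zeta : Cp) : Cp :=
  twisted_Euler_poly h n q zeta 0.

End TwistedEuler.

(* Main.v *)
(* Put w = - q^h zeta and [x] = 1 + q + ... + q^(x-1). On natural numbers the
   integrand times (-q)^x is [x]^n w^x, so up to the factor
   (1 + q) / (1 + q^(p^N)) --> (1 + q) / 2 the N-th approximation of the n-th
   Euler number is A_n(M) = \sum_(x < M) [x]^n w^x with M = p^N. Shifting x by one
   and expanding [x + 1] = 1 + q [x] gives
     w \sum_(l <= n) 'C(n, l) q^l A_l(M) = A_n(M) + [M]^n w^M - 0^n.
   As 1 - w q^n != 0, [p^N] --> 0 and w^(p^N) --> -1, this shows by induction on
   n that A_n(p^N) converges, and its limit is the claimed recurrence. *)
Require Import Defs.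
From HB Require Import structures.
From mathcomp Require Import all_boot all_order all_algebra.
From mathcomp Require Import all_classical all_reals all_analysis.
From mathcomp Require Import ring.

Set Implicit Arguments.
Unset Strict Implicit.
Unset Printing Implicit Defensive.

Import Order.TTheory GRing.Theory Num.Theory.

Local Open Scope ring_scope.

(** * Ultrametric estimates and limit laws *)

Section AbsoluteValue.
Context {R : realType} {K : ultrametricFieldType R}.
Implicit Types x y z : K.
Local Notation v := (@absv R K).

Lemma absv0 : v (0 : K) = 0.
Proof. by rewrite (absv_eq0 0).2. Qed.

Lemma absvX x n : v (x ^+ n) = v x ^+ n.
Proof. by elim: n => [|n IH]; rewrite ?expr0 ?absv1// !exprS absvM IH. Qed.

Lemma absvV x : v x^-1 = (v x)^-1.
Proof.
have [->|x0] := eqVneq x 0; first by rewrite invr0 absv0 invr0.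
have ax0 : v x != 0 by apply/eqP => /absv_eq0/eqP; rewrite (negbTE x0).
by apply: (mulfI ax0); rewrite -absvM !divff// absv1.
Qed.

Lemma absv_exprz x (k : int) : v (x ^ k) = v x ^ k.
Proof. by case: k => n; rewrite ?NegzE -?exprnN ?absvV absvX. Qed.

Lemma absvB_sym x y : v (x - y) = v (y - x).
Proof. by rewrite -opprB absvN. Qed.

Lemma absvD_le x y (B : R) : v x <= B -> v y <= B -> v (x + y) <= B.
Proof. by move=> hx hy; rewrite (le_trans (absvD_max _ _))// ge_max hx. Qed.

Lemma absvD_lt x y (B : R) : v x < B -> v y < B -> v (x + y) < B.
Proof. by move=> hx hy; rewrite (le_lt_trans (absvD_max _ _))// gt_max hx. Qed.

Lemma absv_sum_le (I : Type) (r : seq I) (P : pred I) (F : I -> K) (B : R) :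
  0 <= B -> (forall i, P i -> v (F i) <= B) -> v (\sum_(i <- r | P i) F i) <= B.
Proof.
move=> B0 hF; elim/big_ind: _ => //; first by rewrite absv0.
by move=> x y; apply: absvD_le.
Qed.

Lemma absv_natr_le1 n : v (n%:R : K) <= 1.
Proof.
by elim: n => [|n IH]; rewrite ?absv0// -addn1 natrD absvD_le// absv1.
Qed.

(** If [v z < 1], then [1 = z - (z - 1)] would also have absolute value below 1. *)
Lemma absv_principal z : v (z - 1) < 1 -> v z = 1.
Proof.
move=> hz; apply/eqP; rewrite eq_le; apply/andP; split.
  by rewrite -(subrK 1 z); apply: absvD_le; [exact: ltW|rewrite absv1].
rewrite leNgt; apply/negP => z1.
have : v (1 : K) < 1 by rewrite -(subKr z 1) absvD_lt// absvN.
by rewrite absv1 ltxx.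
Qed.

Lemma principal_neq0 z : v (z - 1) < 1 -> z != 0.
Proof.
move=> /absv_principal z1; apply: contra_eq_neq z1 => ->.
by rewrite absv0 eq_sym oner_eq0.
Qed.

(** The cofactor of [z - 1] in [z ^+ n - 1] is a sum of powers of [z], hence lies in the unit
    ball. *)
Lemma absv_exprn_sub1 z n : v z <= 1 -> v (z ^+ n - 1) <= v (z - 1).
Proof.
move=> z1; rewrite subrX1 absvM ler_piMr ?absv_ge0//.
by apply: absv_sum_le => // i _; rewrite absvX exprn_ile1 ?absv_ge0.
Qed.

Lemma absv_exprz_sub1 z (k : int) : v (z - 1) < 1 -> v (z ^ k - 1) <= v (z - 1).
Proof.
move=> hz; have z1 := absv_principal hz.
case: k => n; first by rewrite absv_exprn_sub1// z1.
rewrite NegzE -invr_expz -exprnP.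
have z0 : z ^+ n.+1 != 0 by rewrite expf_neq0// principal_neq0.
(* An inverse power reduces to a positive one: [a^-1 - 1 = (1 - a) * a^-1], and [a = z ^+ n.+1] has
   absolute value 1. *)
rewrite -[X in _ - X](mulfV z0) -{1}[_^-1]mul1r -mulrBl absvM absvV absvX z1.
by rewrite expr1n invr1 mulr1 absvB_sym absv_exprn_sub1// z1.
Qed.

Lemma absv_mul_sub1 x y : v (x - 1) < 1 -> v (y - 1) < 1 -> v (x * y - 1) < 1.
Proof.
move=> hx hy; have -> : x * y - 1 = (x - 1) * y + (y - 1).
  by rewrite mulrBl mul1r addrA subrK.
by rewrite absvD_lt// absvM (absv_principal hy) mulr1.
Qed.

Lemma hausdorff_absv : hausdorff_space K.
Proof.
rewrite ball_hausdorff => a b ab.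
have d0 : 0 < v (a - b).
  rewrite lt_neqAle absv_ge0 andbT eq_sym; apply/eqP => /absv_eq0/eqP.
  by rewrite subr_eq0 (negbTE ab).
(* The radius need not be halved: by the ultrametric inequality, a common point of the two balls
   would give [v (a - b) < v (a - b)]. *)
exists (PosNum d0, PosNum d0) => /=; apply/eqP; rewrite -subset0 => z [/= az bz].
have : v ((a - z) + (z - b)) < v (a - b).
  by apply: absvD_lt => //; rewrite absvB_sym.
by rewrite subrKA ltxx.
Qed.

Lemma cvg_absvP {T : Type} {F : set_system T} {FF : Filter F}
    (f : T -> K) (l : K) :
  (f x @[x --> F] --> l)%classic <->
  forall e : R, 0 < e -> \forall x \near F, v (f x - l) < e.
Proof.
rewrite cvg_ballP; split => h e e0; apply: filterS (h e e0) => x.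
  by rewrite absvB_sym.
by move=> ?; rewrite /ball/= /absv_ball/= absvB_sym.
Qed.

Section Limits.
Context {T : Type} {F : set_system T} {FF : Filter F}.
Implicit Types f g : T -> K.

Lemma cvgD_absv f g (a b : K) : (f x @[x --> F] --> a)%classic ->
  (g x @[x --> F] --> b)%classic -> (f x + g x @[x --> F] --> a + b)%classic.
Proof.
move=> /cvg_absvP hf /cvg_absvP hg; apply/cvg_absvP => e e0.
near=> x; rewrite opprD addrACA absvD_lt//; near: x; [exact: hf|exact: hg].
Unshelve. all: by end_near.
Qed.

Lemma cvgM_absv f g (a b : K) : (f x @[x --> F] --> a)%classic ->
  (g x @[x --> F] --> b)%classic -> (f x * g x @[x --> F] --> a * b)%classic.
Proof.
move=> /cvg_absvP hf /cvg_absvP hg; apply/cvg_absvP => e e0.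
(* [C] bounds both [v a] and, once [g x] is within 1 of [b], [v (g x)]. *)
pose C := 1 + v a + v b.
have C0 : 0 < C by rewrite /C -addrA ltr_pwDl// addr_ge0 ?absv_ge0.
near=> x.
have -> : f x * g x - a * b = (f x - a) * g x + a * (g x - b).
  by rewrite mulrBl mulrBr subrKA.
have gC : v (g x) <= C.
  rewrite -(subrK b (g x)) (le_trans (absvD _ _))// /C lerD2r.
  have : v (g x - b) <= 1 by apply: ltW; near: x; exact: hg.
  by move=> /le_trans; apply; rewrite /C lerDl absv_ge0.
have aC : v a <= C by rewrite /C addrAC lerDr addr_ge0 ?absv_ge0.
apply: absvD_lt; rewrite absvM.
  rewrite (le_lt_trans (ler_wpM2l (absv_ge0 _) gC))// -ltr_pdivlMr//.
  by near: x; apply: hf; rewrite divr_gt0.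
rewrite (le_lt_trans (ler_wpM2r (absv_ge0 _) aC))// mulrC -ltr_pdivlMr//.
by near: x; apply: hg; rewrite divr_gt0.
Unshelve. all: by end_near.
Qed.

Lemma cvgX_absv f (a : K) n : (f x @[x --> F] --> a)%classic ->
  (f x ^+ n @[x --> F] --> a ^+ n)%classic.
Proof.
move=> hf; elim: n => [|n IH]; first by under eq_fun do rewrite expr0; exact: cvg_cst.
by under eq_fun do rewrite exprS; rewrite exprS; exact: cvgM_absv.
Qed.

Lemma cvg_sum_absv (I : Type) (r : seq I) (P : pred I) (f : I -> T -> K)
    (a : I -> K) :
  (forall i, P i -> (f i x @[x --> F] --> a i)%classic) ->
  (\sum_(i <- r | P i) f i x @[x --> F] --> \sum_(i <- r | P i) a i)%classic.
Proof.
move=> hf; elim: r => [|i r IH].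
  by under eq_fun do rewrite big_nil; rewrite big_nil; exact: cvg_cst.
under eq_fun do rewrite big_cons; rewrite big_cons.
by case: ifP => // Pi; apply: cvgD_absv => //; exact: hf.
Qed.

Lemma cvgMl_absv f (a c : K) : (f x @[x --> F] --> a)%classic ->
  (c * f x @[x --> F] --> c * a)%classic.
Proof. by apply: cvgM_absv; exact: cvg_cst. Qed.

Lemma cvgB_absv f g (a b : K) : (f x @[x --> F] --> a)%classic ->
  (g x @[x --> F] --> b)%classic -> (f x - g x @[x --> F] --> a - b)%classic.
Proof.
move=> hf hg; apply: cvgD_absv => //.
have -> : (fun t => - g t) = (fun t => -1 * g t).
  by apply/funext => t; rewrite mulN1r.
by rewrite -(mulN1r b); exact: cvgMl_absv.
Qed.

Lemma cvgV_absv f (a : K) : a != 0 -> (f x @[x --> F] --> a)%classic ->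
  ((f x)^-1 @[x --> F] --> a^-1)%classic.
Proof.
move=> a0 /cvg_absvP hf; apply/cvg_absvP => e e0.
have pa : 0 < v a.
  by rewrite lt_neqAle absv_ge0 andbT eq_sym; apply: contra_neq a0 => /absv_eq0.
near=> x.
have hx : v (f x - a) < v a by near: x; exact: hf.
(* Near [a] the absolute value cannot drop, since [a = f x - (f x - a)]; so the denominator
   [f x * a] is at least [v a * v a] in absolute value. *)
have fa : v a <= v (f x).
  rewrite leNgt; apply/negP => fxa.
  have : v a < v a by rewrite -{1}(subKr (f x) a) absvD_lt// absvN.
  by rewrite ltxx.
have pf : 0 < v (f x) by exact: lt_le_trans fa.
have f0 : f x != 0 by apply: contraTneq pf => ->; rewrite absv0 ltxx.
have -> : (f x)^-1 - a^-1 = (a - f x) / (f x * a).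
  by rewrite invfM mulrBl mulrCA mulfV// mulr1 mulrA mulfV// mul1r.
rewrite absvM absvV absvM absvB_sym ltr_pdivrMr ?mulr_gt0//.
apply: (@lt_le_trans _ _ (e * (v a * v a))).
  by near: x; apply: hf; rewrite !mulr_gt0.
by rewrite ler_wpM2l ?(ltW e0)// ler_wpM2r ?(ltW pa).
Unshelve. all: by end_near.
Qed.

End Limits.

End AbsoluteValue.

(** * Moment sums of q-numbers *)

Section Moments.
Context {R : realType} {K : ultrametricFieldType R}.
Variables q w : K.

(** The division-free form of the q-number, which treats [q = 1] uniformly. *)
Definition qnat (x : nat) : K := \sum_(i < x) q ^+ i.

Definition moment_sum (n M : nat) : K := \sum_(0 <= x < M) qnat x ^+ n * w ^+ x.

Lemma qnatS x : qnat x.+1 = 1 + q * qnat x.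
Proof.
rewrite /qnat big_ord_recl expr0 mulr_sumr; congr (_ + _).
by apply: eq_bigr => i _; rewrite -exprS.
Qed.

(* Shifting the summation index by one and expanding [x + 1] = 1 + q [x]. *)
Lemma moment_sum_shift n M :
  w * (\sum_(l < n.+1) 'C(n, l)%:R * q ^+ l * moment_sum l M) =
  moment_sum n M + (qnat M ^+ n * w ^+ M - 0 ^+ n).
Proof.
elim: M => [|M IH].
  (* At [M = 0] all moment sums are empty, and the boundary term is [0 ^+ n - 0 ^+ n]. *)
  rewrite /moment_sum big_geq// /qnat big_ord0 expr0 mulr1 subrr addr0 big1 ?mulr0//.
  by move=> l _; rewrite big_geq// mulr0.
have rec l : moment_sum l M.+1 = moment_sum l M + qnat M ^+ l * w ^+ M.
  by rewrite /moment_sum big_nat_recr.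
under eq_bigr do rewrite rec mulrDr.
rewrite big_split mulrDr IH rec -!addrA; congr (_ + (_ + _)); rewrite addrC.
congr (_ - _); rewrite qnatS addrC exprD1n mulr_sumr mulr_suml.
apply: eq_bigr => l _; rewrite exprMn exprS.
by ring.
Qed.

Lemma moment_sum_cvg (M : nat -> nat) (c : K) :
  (forall n, 1 - w * q ^+ n != 0) ->
  (qnat (M N) @[N --> \oo] --> (0 : K))%classic ->
  (w ^+ M N @[N --> \oo] --> c)%classic ->
  exists E : nat -> K,
    (forall n, (moment_sum n (M N) @[N --> \oo] --> E n)%classic) /\
    forall n, w * (\sum_(l < n.+1) 'C(n, l)%:R * q ^+ l * E l) =
              E n + (0 ^+ n * c - 0 ^+ n).
Proof.
move=> nz hM hw.
have cvgE n : exists E : K, (moment_sum n (M N) @[N --> \oo] --> E)%classic.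
  elim/ltn_ind: n => n IH.
  have [E hE] := boolp.choice (fun l : 'I_n => IH l (ltn_ord l)).
  (* The witness solves the shift identity for its top term: [l = n] contributes
     [w * q ^+ n * moment_sum n], which moves to the other side, leaving only lower moments. *)
  exists ((1 - w * q ^+ n)^-1 *
    (w * (\sum_(l < n) 'C(n, l)%:R * q ^+ l * E l) -
     (0 ^+ n * c - 0 ^+ n))).
  suff -> : (fun N => moment_sum n (M N)) = (fun N => (1 - w * q ^+ n)^-1 *
      (w * (\sum_(l < n) 'C(n, l)%:R * q ^+ l * moment_sum l (M N)) -
       (qnat (M N) ^+ n * w ^+ M N - 0 ^+ n))).
    apply/cvgMl_absv/cvgB_absv.
      by apply/cvgMl_absv/cvg_sum_absv => l _; exact: cvgMl_absv.
    by apply: cvgB_absv; [apply: cvgM_absv => //; exact: cvgX_absv|exact: cvg_cst].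
  apply/funext => N; apply: (mulfI (nz n)); rewrite mulrA mulfV// mul1r.
  have := moment_sum_shift n (M N); rewrite big_ord_recr binn mul1r mulrDr /=.
  by move=> /(canRL (addrK _)) ->; ring.
have [E hE] := boolp.choice cvgE; exists E; split=> // n.
(* The two sides of the shift identity are the same sequence, so their limits agree. *)
apply: (cvg_unique (hausdorff_absv (K := K)) (F := (w * (\sum_(l < n.+1)
  'C(n, l)%:R * q ^+ l * moment_sum l (M N)) @[N --> \oo])%classic)).
  by apply/cvgMl_absv/cvg_sum_absv => l _; exact: cvgMl_absv.
rewrite (funext (fun N => moment_sum_shift n (M N))).
apply: cvgD_absv => //; apply: cvgB_absv; last exact: cvg_cst.
by apply: cvgM_absv => //; exact: cvgX_absv.
Qed.

End Moments.

(** * Principal units and p-power maps *)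

Lemma near_exprn_lt (R : realType) (c e : R) : 0 <= c -> c < 1 -> 0 < e ->
  (\forall N \near \oo, c ^+ N < e)%classic.
Proof.
move=> c0 c1 e0.
have hc : `|c| < 1 by rewrite ger0_norm.
have /cvgr0Pnorm_lt/(_ e e0) := @cvg_expr R c hc.
by apply: filterS => N; apply: le_lt_trans; rewrite ler_norm.
Qed.

Section Principal.
Context {R : realType} {K : ultrametricFieldType R} (p : nat).
Hypotheses (p_prime : prime p) (p_small : absv (p%:R : K) < 1 :> R).
Implicit Types z : K.
Local Notation v := (@absv R K).

(** Each p-th power gains one factor of the maximum: for [u = z ^+ (p ^ N)], the cofactor of [u - 1]
    in [u ^+ p - 1] is [p] plus the sum of the [u ^+ i - 1], and all these terms are bounded by that
    maximum. *)
Lemma absv_principal_expp z N : v (z - 1) < 1 ->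
  v (z ^+ (p ^ N) - 1) <= Num.max (v p%:R) (v (z - 1)) ^+ N.+1.
Proof.
move=> hz; set c := Num.max _ _.
have c0 : 0 <= c by rewrite le_max absv_ge0.
have c1 : c < 1 by rewrite gt_max p_small.
elim: N => [|N IH]; first by rewrite expn0 !expr1 le_max lexx orbT.
set u := z ^+ (p ^ N) in IH *.
have uc : v (u - 1) <= c.
  by rewrite (le_trans IH)// exprS ler_piMr// exprn_ile1// ltW.
have v1 : v u = 1 by apply: absv_principal; exact: le_lt_trans c1.
rewrite expnSr exprM -/u subrX1 absvM exprSr ler_pM ?absv_ge0//.
have -> : \sum_(i < p) u ^+ i = p%:R + \sum_(i < p) (u ^+ i - 1).
  by rewrite sumrB sumr_const card_ord addrC subrK.
apply: absvD_le; first by rewrite le_max lexx.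
apply: absv_sum_le => // i _.
by rewrite (le_trans _ uc)// absv_exprn_sub1// v1.
Qed.

Lemma cvg_principal_expp z : v (z - 1) < 1 ->
  (z ^+ (p ^ N) @[N --> \oo] --> (1 : K))%classic.
Proof.
move=> hz; apply/cvg_absvP => e e0.
pose c := Num.max (v p%:R) (v (z - 1)).
have c0 : 0 <= c by rewrite le_max absv_ge0.
have c1 : c < 1 by rewrite gt_max p_small.
apply: filterS (near_exprn_lt c0 c1 e0) => N.
apply: le_lt_trans; rewrite (le_trans (absv_principal_expp _ hz))//.
by rewrite exprS ler_piMl ?exprn_ge0// ltW.
Qed.

(* By the binomial theorem (z - 1)^p and z^p - 1 agree modulo p. *)
Lemma principal_of_expp z :
  odd p -> v z <= 1 -> v (z ^+ p - 1) < 1 -> v (z - 1) < 1.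
Proof.
move=> p_odd z1 hz; have p0 := prime_gt0 p_prime.
rewrite -(expr_lt1 p0) ?absv_ge0// -absvX exprBn.
(* The end terms are split off: as [p] is odd they are [z ^+ p] and -1, which together are small by
   hypothesis. *)
rewrite -(prednK p0) big_ord_recl big_ord_recr /= prednK//.
rewrite !bin0 !expr0 !expr1n !mulr1 mul1r subn0 !mulr1n.
rewrite /bump /= add1n prednK// subnn binn expr0 !mulr1 mulr1n.
rewrite -signr_odd p_odd expr1 addrCA addrC -addrA addrC addrAC.
apply: absvD_lt; first by rewrite addrC.
apply: le_lt_trans p_small; apply: absv_sum_le => [|i _]; first exact: absv_ge0.
have /dvdnP[k ->] : (p %| 'C(p, 1 + i))%N.
  by rewrite prime_dvd_bin// add1n/= -[X in (_ < X)%N](prednK p0) ltnS.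
rewrite expr1n mulr1 -mulr_natr natrM mulrA absvM ler_piMl ?absv_ge0//.
rewrite !absvM !absvX absvN absv1 expr1n mul1r.
by rewrite mulr_ile1 ?exprn_ge0 ?absv_ge0 ?absv_natr_le1// exprn_ile1 ?absv_ge0.
Qed.

(** Descent from [z ^+ (p ^ N) = 1] to [z], removing one p-th power at a time with
    [principal_of_expp]. *)
Lemma principal_unity_root z N : odd p -> z ^+ (p ^ N) = 1 -> v (z - 1) < 1.
Proof.
move=> p_odd hz; have p0 := prime_gt0 p_prime.
have z1 : v z = 1.
  apply/eqP; rewrite -(@pexpr_eq1 _ _ (p ^ N)) ?absv_ge0 ?expn_gt0 ?p0//.
  by rewrite -absvX hz absv1.
have : v (z ^+ (p ^ N) - 1) < 1 by rewrite hz subrr absv0.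
elim: N {hz} => [|N IH] //; rewrite expnSr exprM => h.
by apply: IH; apply: principal_of_expp => //; rewrite absvX z1 expr1n.
Qed.

(** If 2 were small, so would be [1 = p - 2 * p./2]. *)
Lemma absv_two : odd p -> v 2 = 1.
Proof.
move=> p_odd; apply/eqP; rewrite eq_le absv_natr_le1 leNgt; apply/negP => h.
have : v (p%:R - p./2%:R * 2) < 1.
  rewrite absvD_lt// absvN absvM (le_lt_trans _ h)//.
  by rewrite ler_piMl ?absv_ge0// absv_natr_le1.
rewrite -{1}(odd_double_half p) p_odd -muln2 natrD natrM addrK absv1.
by rewrite ltxx.
Qed.

End Principal.

(** * p-adic powers with integer exponents *)

Section PadicInterpolation.
Context {R : realType} {p : nat} {Qp : ultrametricFieldType R}.
Hypotheses (p_prime : prime p) (hQp : is_Qp p Qp).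
Local Notation Zp := (valuation_ring Qp).

Lemma absv_Qp_int (m : int) : m != 0 ->
  absv (m%:~R : Qp) = (p%:R ^+ logn p `|m|%N)^-1 :> R.
Proof.
case: hQp => _ + _ m0 => /(_ m%:~R); rewrite ratr_int => ->.
by rewrite /padic_abs intr_eq0 (negbTE m0) numq_int denq_int logn1 expr0 div1r.
Qed.

Lemma absv_Qp_p : absv (p%:R : Qp) = p%:R^-1 :> R.
Proof.
rewrite pmulrn absv_Qp_int; last by rewrite eqz_nat -lt0n prime_gt0.
by rewrite /= logn_prime// eqxx expr1.
Qed.

Lemma Qp_ball_dvd (m : int) N :
  absv (m%:~R : Qp) < (p%:R ^+ N)^-1 :> R -> (p ^ N %| `|m|)%N.
Proof.
have [->|m0] := eqVneq m 0; first by rewrite absz0 dvdn0.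
have p0 : (0 < p%:R :> R) by rewrite ltr0n prime_gt0.
rewrite absv_Qp_int// ltf_pV2 ?posrE ?exprn_gt0// ltr_eXn2l ?ltr1n ?prime_gt1//.
by rewrite pfactor_dvdn// ?absz_gt0// => /ltnW.
Qed.

(** The issue is that every neighbourhood of [m] contains a natural number, also for negative [m],
    which occurs for the exponents [(h - 1) * x]. *)
Lemma padic_near_proper (m : int) (y : Zp) : vring_val y = m%:~R ->
  ProperFilter (padic_near y).
Proof.
move=> ym; apply: filter_from_proper; first apply: filter_from_filter.
- by exists setT; exact: filterT.
- move=> A B hA hB; exists (A `&` B)%classic; last by [].
  exact: filterI.
move=> B /nbhs_ballP[e /= e0 hB].
have p0 : (0 < p%:R :> R) by rewrite ltr0n prime_gt0.
have : (p%:R^-1 < 1 :> R) by rewrite invf_lt1// ltr1n prime_gt1.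
move=> p1; have pV0 : 0 <= p%:R^-1 :> R by rewrite invr_ge0 ltW.
have [N _ /(_ N (leqnn N)) /= hN] := near_exprn_lt pV0 p1 e0.
(* Adding [|m| * p ^ N] makes [m] nonnegative while moving it p-adically by less than [e]. *)
have [k hk] : exists k : nat, k%:Z = m + (`|m|%N * p ^ N)%N%:Z.
  exists (absz (m + (`|m|%N * p ^ N)%N%:Z)); rewrite gez0_abs//.
  rewrite -lerBlDl sub0r (@le_trans _ _ `|m|%N%:Z)//.
    by rewrite abszE -normrN ler_norm.
  by rewrite lez_nat leq_pmulr// expn_gt0 prime_gt0.
exists k => /=; apply: hB; rewrite /ball/= /absv_ball/= ym.
rewrite pmulrn hk intrD opprD addNKr absvN -pmulrn natrM absvM.
rewrite natrX absvX absv_Qp_p (le_lt_trans _ hN)//.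
by rewrite ler_piMl ?exprn_ge0// absv_natr_le1.
Qed.

(* q |-> q ^ m is continuous for the p-adic topology on the integers m because
   q ^ (p ^ N) --> 1. *)
Lemma padic_pow_int {Cp : ultrametricFieldType R} (z : Cp) (m : int) (y : Zp) :
  absv (p%:R : Cp) < 1 :> R -> absv (z - 1) < 1 :> R ->
  vring_val y = m%:~R -> padic_pow z y = z ^ m.
Proof.
move=> p_small hz ym; have FF := padic_near_proper ym.
apply: cvg_lim; first exact: hausdorff_absv.
apply/cvg_absvP => e e0.
have [N _ /(_ N (leqnn N)) /= hN] :=
  (cvg_absvP _ _).1 (cvg_principal_expp p_small hz) e e0.
have p0 : (0 < (p%:R ^+ N)^-1 :> R) by rewrite invr_gt0 exprn_gt0// ltr0n prime_gt0.
exists (ball (vring_val y) (p%:R ^+ N)^-1); first exact: nbhsx_ballx.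
move=> n /=; rewrite /ball/= /absv_ball/= ym pmulrn absvB_sym -intrB.
move=> /Qp_ball_dvd dvd_n.
have /dvdzP[k hk] : ((p ^ N)%N%:Z %| n%:Z - m)%Z by [].
(* Since [n - m = k * p ^ N], the first factor is a power of [z ^+ (p ^ N)] minus 1, hence smaller
   than [e]; the second has absolute value 1. *)
have -> : z ^+ n - z ^ m = (z ^ (n%:Z - m) - 1) * z ^ m.
  by rewrite mulrBl mul1r -expfzDr ?subrK ?principal_neq0.
have z1 := absv_principal hz.
have hzN : absv (z ^+ (p ^ N) - 1) < 1 :> R.
  by rewrite (le_lt_trans (absv_exprn_sub1 _ _)) ?z1.
rewrite absvM absv_exprz z1 exp1rz mulr1 hk mulrC -exprz_exp.
exact: le_lt_trans (absv_exprz_sub1 _ hzN) hN.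
Qed.

End PadicInterpolation.

(** * Euler numbers as limits of moment sums *)

Section TwistedEulerNumber.
Context {R : realType} {p : nat} {Qp Cp : ultrametricFieldType R}.
Context {iota : {rmorphism Qp -> Cp}}.
Hypotheses (p_prime : prime p) (hQp : is_Qp p Qp) (hCp : is_Cp iota).

Lemma absv_Cp_p : absv (p%:R : Cp) < 1 :> R.
Proof.
have [L [i [j [[_ iso_i iotaE] [_ iso_j _]]]]] := hCp.
rewrite -(rmorph_nat iota) iotaE /= iso_j iso_i (absv_Qp_p p_prime hQp).
by rewrite invf_lt1 ?ltr0n ?ltr1n ?prime_gt1 ?prime_gt0.
Qed.

Lemma vring_val_nat (x : nat) : vring_val (x%:R : valuation_ring Qp) = x%:R.
Proof. exact: (rmorph_nat (val : valuation_ring Qp -> Qp)). Qed.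

Lemma qnum_nat (q : Cp) (x : nat) : absv (q - 1) < 1 :> R ->
  qnum iota q (x%:R : valuation_ring Qp) = qnat q x.
Proof.
move=> hq; have valx := vring_val_nat x.
rewrite /qnum /qnat; case: eqVneq => [->|q1].
  rewrite valx rmorph_nat; under eq_bigr do rewrite expr1n.
  by rewrite sumr_const card_ord.
rewrite (padic_pow_int p_prime hQp (m := x) absv_Cp_p hq) ?valx ?pmulrn//.
rewrite -exprnP -opprB subrX1 -(opprB q 1) invrN mulrNN mulrAC mulfV ?mul1r//.
by rewrite subr_eq0.
Qed.

Lemma Euler_integrand_nat (h : int) (n x : nat) (q zeta : Cp) :
  absv (q - 1) < 1 :> R -> absv (zeta - 1) < 1 :> R ->
  qnum iota q (0 + x%:R) ^+ n * padic_pow zeta (x%:R : valuation_ring Qp) *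
    padic_pow q ((h - 1)%:~R * (x%:R : valuation_ring Qp)) * (- q) ^+ x =
  qnat q x ^+ n * (- (q ^ h * zeta)) ^+ x.
Proof.
move=> hq hz; rewrite add0r qnum_nat//.
have valx := vring_val_nat x.
have valhx : vring_val ((h - 1)%:~R * (x%:R : valuation_ring Qp)) =
    ((h - 1) * x)%:~R.
  rewrite [x%:R]pmulrn -intrM.
  exact: (rmorph_int (val : valuation_ring Qp -> Qp)).
rewrite (padic_pow_int p_prime hQp (m := x) absv_Cp_p hz) ?valx ?pmulrn//.
rewrite (padic_pow_int p_prime hQp absv_Cp_p hq valhx).
rewrite -exprz_exp -!exprnP -!mulrA -!exprMn; congr (_ * _ ^+ _).
(* The weight [- q] of the measure supplies the sign and the factor [q] missing from
   [q ^ (h - 1)]. *)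
have -> : q ^ h = q ^ (h - 1) * q.
  by rewrite -[X in _ * X]expr1z -expfzDr ?principal_neq0// subrK.
by ring.
Qed.

End TwistedEulerNumber.

Theorem theorem3 (R : realType) (p : nat)
    (Qp Cp : ultrametricFieldType R) (iota : {rmorphism Qp -> Cp})
    (p_prime : prime p) (p_odd : odd p)
    (hQp : is_Qp p Qp) (hCp : is_Cp iota)
    (q : Cp) (hq : absv (q - 1) < 1 :> R)
    (h : int) (zeta : Cp) (hzeta : Tp p zeta) :
  twisted_Euler_number p iota h 0 q zeta = (1 + q) / (1 + q ^ h * zeta) /\
  forall n : nat, (0 < n)%N ->
    q ^ h * zeta *
      (\sum_(l < n.+1) ('C(n, l))%:R * q ^+ l *
                       twisted_Euler_number p iota h l q zeta)
    + twisted_Euler_number p iota h n q zeta = 0.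
Proof.
have p_small : absv (p%:R : Cp) < 1 :> R := absv_Cp_p p_prime hQp hCp.
have [k [_ zk]] := hzeta.
have hz := principal_unity_root p_prime p_small p_odd zk.
pose u := q ^ h * zeta.
have hu : absv (u - 1) < 1 :> R.
  by rewrite absv_mul_sub1// (le_lt_trans (absv_exprz_sub1 _ hq)).
(* If [1 + y = 0], then [y - 1 = -2], which has absolute value 1 because [p] is odd. *)
have one_plus_neq0 (y : Cp) : absv (y - 1) < 1 :> R -> 1 + y != 0.
  move=> hy; apply/eqP => y0; have := absv_two p_small p_odd.
  have -> : (2 : Cp) = - (y - 1) by rewrite opprB -[RHS]addr0 -y0; ring.
  by rewrite absvN => y1; rewrite y1 ltxx in hy.
have nz n : 1 - (- u) * q ^+ n != 0.
  rewrite mulNr opprK one_plus_neq0// absv_mul_sub1//.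
  by rewrite (le_lt_trans (absv_exprn_sub1 _ _)) ?(absv_principal hq).
have cq := cvg_principal_expp p_small hq.
have [E [cE recE]] : exists E : nat -> Cp,
    (forall n, (moment_sum q (- u) n (p ^ N) @[N --> \oo] --> E n)%classic) /\
    forall n, (- u) * (\sum_(l < n.+1) 'C(n, l)%:R * q ^+ l * E l) =
              E n + (0 ^+ n * -1 - 0 ^+ n).
  apply: moment_sum_cvg => //.
    (* For [q = 1] the q-number of [p ^ N] is [p ^ N] itself; otherwise it is
       [(q ^+ (p ^ N) - 1) / (q - 1)]. *)
    have [q1|q1] := eqVneq q 1.
      rewrite (_ : (fun N => _) = (fun N => (p%:R : Cp) ^+ N)).
        apply/cvg_absvP => e e0.
        apply: filterS (near_exprn_lt (absv_ge0 _) p_small e0) => N.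
        by rewrite subr0 absvX.
      apply/funext => N; rewrite /qnat q1; under eq_bigr do rewrite expr1n.
      by rewrite sumr_const card_ord natrX.
    rewrite (_ : (fun N => _) = (fun N => (q - 1)^-1 * (q ^+ (p ^ N) - 1))).
      rewrite -[0](mulr0 (q - 1)^-1) -(subrr 1).
      by apply/cvgMl_absv/cvgB_absv => //; exact: cvg_cst.
    by apply/funext => N; rewrite subrX1 mulKf// subr_eq0.
  (* The exponent [p ^ N] is odd, so the sign survives and the limit is -1. *)
  rewrite (_ : (fun N => _) = (fun N => -1 * u ^+ (p ^ N))).
    have := cvgMl_absv (c := -1) (cvg_principal_expp p_small hu); rewrite mulr1; exact.
  by apply/funext => N; rewrite exprNn -signr_odd oddX p_odd orbT.
pose c : Cp := (1 + q) / 2.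
have EulerE n : twisted_Euler_number p iota h n q zeta = c * E n.
  apply: cvg_lim; first exact: hausdorff_absv.
  under eq_fun do under eq_bigr do rewrite (Euler_integrand_nat p_prime hQp hCp)//.
  apply: cvgM_absv; last exact: cE.
  rewrite /c; apply/cvgMl_absv/cvgV_absv.
    by rewrite one_plus_neq0// subrr absv0.
  by apply: cvgD_absv => //; exact: cvg_cst.
have two0 : (2 : Cp) != 0 by rewrite one_plus_neq0// subrr absv0.
have u0 := one_plus_neq0 _ hu.
rewrite -/u; split => [|n n0].
  (* As [0 ^+ 0 = 1], the boundary term is -2 here, which gives [(1 + u) * E 0 = 2]. *)
  have := recE 0%N; rewrite big_ord1 bin0 !expr0 !mul1r EulerE => E0.
  apply: (mulIf u0); rewrite divfK// /c.
  have -> : (1 + q) / 2 * E 0%N * (1 + u) =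
      (1 + q) / 2 * (E 0%N - (- u) * E 0%N) by ring.
  by rewrite E0; field.
(* For [n > 0] the boundary term vanishes, and the homogeneous relation is preserved by the common
   factor [c]. *)
have := recE n; rewrite expr0n eqn0Ngt n0 mul0r subr0 addr0 EulerE => <-.
under eq_bigr do rewrite EulerE mulrCA.
by rewrite -mulr_sumr; ring.
Qed.
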